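(* With $a(k),b(k),c(k),d(k)$ as defined in the context, $a(k)=c(k)$ for all integers $k\ge0$, and $b(k)=d(k)$ for all integers $k\ge1$.
   Context: Partitions are written $(\lambda_1^{f_1},\lambda_2^{f_2},\dots,\lambda_j^{f_j})$ with $\lambda_1>\lambda_2>\cdots>\lambda_j>0$ the distinct parts and $f_i\ge 1$ the multiplicity of the part $\lambda_i$; the empty partition is the unique partition of $0$ (and satisfies all conditions vacuously), and negative integers have no partitions. Call a partition admissible if $0<f_i<3$ for all $i\le j$, $f_1\equiv\lambda_1\pmod 3$, and $f_i+f_{i+1}+\lambda_i-\lambda_{i+1}\equiv0\pmod 3$ for all $i<j$. Define $a(k)$ := number of admissible partitions of $3k$; $b(k)$ := number of admissible partitions of $3k-2$; $c(k)$ := (number of partitions of $k$ into parts $\not\equiv0,\pm7\pmod{15}$) $-$ (number of partitions of $k-1$ into parts $\not\equiv0,\pm2\pmod{15}$); $d(k)$ := (number of partitions of $k-1$ into parts $\not\equiv0,\pm4\pmod{15}$) $+$ (number of partitions of $k-2$ into parts $\not\equiv0,\pm1\pmod{15}$). *)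

(* Defs.v *)
From mathcomp Require Import all_boot all_order all_algebra.

Set Implicit Arguments.
Unset Strict Implicit.
Unset Printing Implicit Defensive.

Import Order.TTheory GRing.Theory Num.Theory.

Local Open Scope nat_scope.

(* A partition is the weakly decreasing sequence of its parts, repeated
   according to multiplicity. *)
Definition is_partition (n : int) (p : seq nat) : bool :=
  [&& sorted geq p, 0 \notin p & ((sumn p)%:Z == n)%R].

(* A partition of n has at most n parts, each at most n, so all of them occur
   among the sequences of size at most |n| with entries in {0, ..., |n|}.
   For negative n none of these sequences is a partition of n. *)
Definition num_partitions (n : int) (P : pred (seq nat)) : nat :=
  #|[set s : `|n|%N.-bseq 'I_(`|n|%N.+1) |
      is_partition n (map val s) && P (map val s)]|.

(* In (lambda_1^f_1, ..., lambda_j^f_j), with indices shifted to start at 0: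
   j = size (parts p), lambda_(i+1) = part p i and f_(i+1) = mult p i. *)
Definition parts (p : seq nat) : seq nat := undup p.
Definition part (p : seq nat) (i : nat) : nat := nth 0 (parts p) i.
Definition mult (p : seq nat) (i : nat) : nat := count_mem (part p i) p.

Definition admissible (p : seq nat) : bool :=
  let j := size (parts p) in
  [&& [forall i : 'I_j, 0 < mult p i < 3],
      (0 < j) ==> (mult p 0 == part p 0 %[mod 3])
    & [forall i : 'I_j, (i.+1 < j) ==>
        (((mult p i)%:Z + (mult p i.+1)%:Z + (part p i)%:Z
            - (part p i.+1)%:Z)%R == 0%R %[mod 3])%Z]].

Definition parts_avoid (r : nat) (p : seq nat) : bool :=
  all (fun x : nat => [&& (x%:Z != 0 %[mod 15])%Z,
                          (x%:Z != r%:Z %[mod 15])%Z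
                        & (x%:Z != (- r%:Z)%R %[mod 15])%Z]) p.

Local Open Scope ring_scope.

Definition a (k : int) : int := (num_partitions (3 * k) admissible)%:Z.

Definition b (k : int) : int := (num_partitions (3 * k - 2) admissible)%:Z.

Definition c (k : int) : int :=
  (num_partitions k (parts_avoid 7))%:Z
  - (num_partitions (k - 1) (parts_avoid 2))%:Z.

Definition d (k : int) : int :=
  (num_partitions (k - 1) (parts_avoid 4))%:Z
  + (num_partitions (k - 2) (parts_avoid 1))%:Z.

Local Open Scope nat_scope.

Lemma size_partition (p : seq nat) : 0 \notin p -> size p <= sumn p.
Proof.
elim: p => //= x p IHp; rewrite inE negb_or eq_sym -lt0n => /andP[x_gt0 /IHp].
by move=> le_p; rewrite -add1n leq_add.
Qed.

Lemma part_le_sumn (p : seq nat) x : x \in p -> x <= sumn p.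
Proof.
elim: p => //= y p IHp; rewrite inE => /predU1P[->|/IHp xp].
  exact: leq_addr.
exact: leq_trans xp (leq_addl _ _).
Qed.

(* num_partitions n P counts the partitions of n that satisfy P. *)
Lemma num_partitionsE n P (e : seq (seq nat)) :
  uniq e -> (forall p, p \in e = is_partition n p && P p) ->
  num_partitions n P = size e.
Proof.
move=> Ue eE; rewrite /num_partitions cardE.
set A := [set s | _]; pose f (s : `|n|%N.-bseq 'I_(`|n|%N.+1)) := map val s.
have inj_f : injective f by move=> s t /(inj_map val_inj)/val_inj.
rewrite -(size_map f); apply/perm_size/uniq_perm => //.
  by rewrite map_inj_uniq // enum_uniq.
move=> p; rewrite eE; apply/mapP/idP => [[s]|pP].
  by rewrite mem_enum inE => + ->.
have /andP[/and3P[_ p0 /eqP np] _] := pP.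
have lt_p : all (fun x => x < `|n|%N.+1) p.
  by apply/allP => x /part_le_sumn; rewrite -np.
have [q pq] : exists q : seq 'I_(`|n|%N.+1), p = map val q.
  exists (pmap insub p); rewrite pmap_filter ?(eq_filter (isSome_insub _)).
    by rewrite (all_filterP lt_p).
  by move=> x; rewrite /= insubK.
have sz_q : size q <= `|n|%N.
  by rewrite -(size_map val) -pq -np size_partition.
by exists (Bseq sz_q) => //; rewrite mem_enum inE /= -pq.
Qed.

(* Main.v *)
Require Import Defs.
From mathcomp Require Import all_boot all_order all_algebra.
From mathcomp Require Import ring zify.

Set Implicit Arguments.
Unset Strict Implicit.
Unset Printing Implicit Defensive.

Import Order.TTheory GRing.Theory Num.Theory.

(** Write Q = q^3.  Reading a partition from its largest part, the
    admissibility of the next part depends only on the number modulo 3 of parts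
    already read, and this turns the generating function of the admissible
    partitions into the double sums
      f^c(a, b) = sum over n1 - n2 = c (mod 3) of
                  q^(2(n1^2 + n1 n2 + n2^2) + a n1 + b n2) / ((Q)_n1 (Q)_n2):
    the partitions of the multiples of 3 give f^0(0, 0), the others
    f^2(-2, -1).  Replacing 1 / ((Q)_n1 (Q)_n2) by the Q-multinomial
    coefficient (Q)_M / ((Q)_n1 (Q)_n2 (Q)_(M - n1 - n2)) gives polynomials
    Y_M, X_M satisfying
      Y_(M+1) = (1 - Q^(2M+1)) Y_M + q^2 Q^M X_(M+1),
      X_(M+1) = (1 + Q^M) X_M + q Q^M Y_M.
    The same recurrences are satisfied by
      sum over N <> 2 (mod 3) of (-1)^N q^(N(5N+1)/2) [2M, M-N]_Q,
      - sum over N <> 0 (mod 3) of (-1)^N q^(N(5N-3)/2) [2M-1, M-N]_Q,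
    and letting M grow leaves theta series divided by (Q)_oo, which Jacobi's
    triple product modulo 15 identifies with the partition functions of the
    right-hand sides.

    Power series are replaced by the quotient of {poly int} by 'X^N: limits
    become equalities in a ring in which q^N = 0. *)

Local Open Scope ring_scope.

(** * Q-multinomial double sums *)

Lemma Z3_addDD (c : 'Z_3) : c + 1 + 1 = c - 1.
Proof. by case: c => [[|[|[|]]] ?] //; apply/val_inj. Qed.

Lemma Z3_subBB (c : 'Z_3) : c - 1 - 1 = c + 1.
Proof. by case: c => [[|[|[|]]] ?] //; apply/val_inj. Qed.

Lemma subKr_eq (V : zmodType) (x y z : V) : x - y = z -> y = x - z.
Proof. by move=> <-; rewrite subKr. Qed.

Section WordSum.

Variables (R : comNzRingType) (q : R).
Local Notation Q := (q ^+ 3).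

(** [word_sum M c a b] is the sum over n1 - n2 = c (mod 3) of
    q^(2(n1(n1-1) + n1 n2 + n2(n2-1)) + a n1 + b n2) times the Q-multinomial
    coefficient of (M - n1 - n2, n1, n2), defined by the q-Pascal rule; the
    arguments [a] and [b] exceed those of f^c(a, b) by 2. *)
Fixpoint word_sum (M : nat) (c : 'Z_3) (a b : nat) : R :=
  if M is M'.+1 then
    word_sum M' c a.+3 b.+3 + q ^+ a * word_sum M' (c - 1) a.+4 b.+2
      + q ^+ b * word_sum M' (c + 1) a.+4.+1 b.+4
  else (c == 0)%:R.

Local Notation F := word_sum.

Lemma word_sumS M c a b :
  F M.+1 c a b = F M c a.+3 b.+3 + q ^+ a * F M (c - 1) a.+4 b.+2
    + q ^+ b * F M (c + 1) a.+4.+1 b.+4.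
Proof. by []. Qed.

(** Raising a by 3 weights the summand by Q^n1, and 1 - Q^n1 times the multinomial coefficient of M
    + 1 is 1 - Q^(M+1) times that of M with n1 lowered by one. *)
Lemma word_sum_shift1 M c a b :
  F M.+1 c a b - F M.+1 c a.+3 b
    = (1 - Q ^+ M.+1) * q ^+ a * F M (c - 1) a.+4 b.+2.
Proof.
elim: M c a b => [|M IH] c a b; first by rewrite /= !exprS !expr0; ring.
have e2 := subKr_eq (IH (c - 1) a.+4 b.+2).
have /eqP := IH c a.+3 b.+3; rewrite subr_eq => /eqP e1.
have /eqP := IH (c + 1) a.+4.+1 b.+4; rewrite subr_eq => /eqP e3.
rewrite (word_sumS M.+1) [F M.+2 c a.+3 b]word_sumS e2 e1 e3.
rewrite !(word_sumS M (c - 1) a.+4) Z3_subBB addrK subrK !exprS.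
ring.
Qed.

Lemma word_sum_shift2 M c a b :
  F M.+1 c a b - F M.+1 c a b.+3
    = (1 - Q ^+ M.+1) * q ^+ b * F M (c + 1) a.+2 b.+4.
Proof.
elim: M c a b => [|M IH] c a b; first by rewrite /= !exprS !expr0; ring.
have /eqP := IH (c - 1) a.+4 b.+2; rewrite subr_eq => /eqP e2.
have /eqP := IH c a.+3 b.+3; rewrite subr_eq => /eqP e1.
have e3 := subKr_eq (IH (c + 1) a.+4.+1 b.+4).
have e4 := subKr_eq (word_sum_shift1 M (c + 1) a.+2 b.+4).
rewrite (word_sumS M.+1) [F M.+2 c a b.+3]word_sumS e3 e1 e2 e4.
rewrite !(word_sumS M (c + 1) a.+2) Z3_addDD addrK subrK !exprS.
ring.
Qed.

(** With n0 = M + 1 - n1 - n2, this is the absorption of 1 - Q^n0, because Q^(n1+n2) - Q^(M+1) =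
    Q^(n1+n2) (1 - Q^n0). *)
Lemma word_sum_shift12 M c a b :
  F M.+1 c a.+3 b.+3
    = (1 - Q ^+ M.+1) * F M c a.+3 b.+3 + Q ^+ M.+1 * F M.+1 c a b.
Proof.
rewrite (subKr_eq (word_sum_shift2 M c a.+3 b)).
rewrite (subKr_eq (word_sum_shift1 M c a b)).
rewrite !(word_sumS M c a b).
ring.
Qed.

(** The quadratic form and the multinomial coefficient are symmetric in n1 and n2; only the Pascal
    rule of the definition treats them differently. *)
Lemma word_sum_mirror M c a b : F M c a b = F M (- c) b a.
Proof.
elim: M c a b => [|M IH] c a b; first by rewrite /= oppr_eq0.
rewrite !word_sumS [in RHS]IH opprK [F M (- c - 1) _ _]IH [F M (- c + 1) _ _]IH.
rewrite !opprD !opprK.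
case: M IH => [|M] IH; first by rewrite /=; ring.
have /eqP := word_sum_shift2 M (c - 1) a.+4 b.+2; rewrite subr_eq => /eqP ->.
have /eqP := word_sum_shift1 M (c + 1) a.+2 b.+4; rewrite subr_eq => /eqP ->.
rewrite subrK addrK !exprS.
ring.
Qed.

(** The Pascal rule depends on an ordering of the three letters. The definition uses n1, n2, n0;
    here the order is n1, n0, n2. *)
Lemma word_sumS_mid M c a b :
  F M.+1 c a b = F M c a.+3 b + q ^+ a * F M (c - 1) a.+4 b.+2
    + q ^+ b * Q ^+ M * F M (c + 1) a.+2 b.+1.
Proof.
rewrite word_sumS; case: M => [|M]; first by rewrite /= expr0; ring.
have /eqP := word_sum_shift2 M c a.+3 b; rewrite subr_eq => /eqP ->.
rewrite [F M.+1 (c + 1) a.+4.+1 b.+4]word_sum_shift12.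
ring.
Qed.

(** The Pascal rule for the order n0, n1, n2. All terms but the first carry Q^M, which makes the
    sums stabilise as M grows. The argument [b.+1] keeps the exponent b + 1 + 2 - 3 nonnegative. *)
Lemma word_sumS_hd M c a b :
  F M.+1 c a b.+1 = F M c a b.+1 + q ^+ a * Q ^+ M * F M (c - 1) a.+1 b
    + q ^+ b.+1 * Q ^+ M * F M (c + 1) a.+2 b.+2.
Proof.
rewrite word_sumS_mid; case: M => [|M]; first by rewrite /= !expr0; ring.
have /eqP := word_sum_shift1 M c a b.+1; rewrite subr_eq => /eqP ->.
rewrite [F M.+1 (c - 1) a.+4 b.+3]word_sum_shift12.
ring.
Qed.

(** The polynomials Y_M and X_M. *)
Definition vac_poly M := F M 0 2 2.
Definition eps_poly M := F M (- 1) 0 1.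

Lemma vac_polyS M :
  vac_poly M.+1 = (1 - Q ^+ (2 * M).+1) * vac_poly M
    + q ^+ 2 * Q ^+ M * eps_poly M.+1.
Proof.
rewrite /vac_poly /eps_poly word_sumS_hd (word_sumS_mid M (- 1)).
rewrite (_ : -1 - 1 = 1 :> 'Z_3); last exact/val_inj.
rewrite (_ : -1 + 1 = 0 :> 'Z_3); last exact/val_inj.
rewrite sub0r add0r !exprS mulnC exprM ?expr0 ?expr1.
ring.
Qed.

Lemma eps_polyS M :
  eps_poly M.+1 = (1 + Q ^+ M) * eps_poly M + q * Q ^+ M * vac_poly M.
Proof.
rewrite /eps_poly /vac_poly word_sumS_hd.
rewrite [F M (-1 - 1) _ _]word_sum_mirror.
rewrite (_ : -(-1 - 1) = -1 :> 'Z_3); last exact/val_inj.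
rewrite (_ : -1 + 1 = 0 :> 'Z_3) ?expr1 ?expr0; last exact/val_inj.
ring.
Qed.

End WordSum.

(** * Admissible partitions and double sums *)

Section Nilpotent.

Variables (R : comNzRingType) (q : R) (N : nat).
Hypothesis qN : q ^+ N = 0.
Local Notation F := (word_sum q).

Lemma exp_nilp k : (N <= k)%N -> q ^+ k = 0.
Proof. by move=> /subnK <-; rewrite exprD qN mulr0. Qed.

Lemma word_sum_stable M c a b :
  (N <= M)%N -> F M c a b.+1 = F N c a b.+1.
Proof.
elim: M => [|M IH]; first by rewrite leqn0 => /eqP ->.
rewrite leq_eqVlt => /predU1P[->//|]; rewrite ltnS => NM.
rewrite word_sumS_hd -exprM (@exp_nilp (3 * M));
  last exact: leq_trans (leq_pmull _ _).
by rewrite !mulr0 !mul0r !addr0 IH.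
Qed.

Lemma word_sum_large M c a b :
  (N <= a)%N -> (N <= b)%N -> F M c a b = (c == 0)%:R.
Proof.
elim: M a b => [//|M IH] a b Na Nb.
rewrite word_sumS !exp_nilp // !mul0r !addr0 IH //; lia.
Qed.

Lemma word_sum_shift1_lim c a b :
  F N.+1 c a b = F N.+1 c a.+3 b + q ^+ a * F N.+1 (c - 1) a.+4 b.+2.
Proof.
have := word_sum_shift1 q N c a b.
rewrite -exprM (@exp_nilp (3 * N.+1)); last lia.
rewrite subr0 mul1r => /eqP; rewrite subr_eq => /eqP ->.
by rewrite addrC (@word_sum_stable N.+1 (_ _)) ?leqnSn.
Qed.

Lemma word_sum_shift2_lim c a b :
  F N.+1 c a b = F N.+1 c a b.+3 + q ^+ b * F N.+1 (c + 1) a.+2 b.+4.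
Proof.
have := word_sum_shift2 q N c a b.
rewrite -exprM (@exp_nilp (3 * N.+1)); last lia.
rewrite subr0 mul1r => /eqP; rewrite subr_eq => /eqP ->.
by rewrite addrC (@word_sum_stable N.+1 (_ _)) ?leqnSn.
Qed.

(** Here 1 - Q^(n1+n2) = (1 - Q^n1) + Q^n1 (1 - Q^n2) gives two sums. They merge into one because
    q^(2a+1) = q^a q^(a+1) and c + 1 = c - 2 modulo 3. *)
Lemma word_sum_diag_lim c a :
  F N.+1 c a (2 * a).+1
    = F N.+1 c a.+3 (2 * a).+4 + q ^+ a * F N.+1 (c - 1) a.+1 (2 * a).+3.
Proof.
rewrite (word_sum_shift1_lim (c - 1) a.+1) word_sum_shift1_lim.
rewrite (word_sum_shift2_lim c a.+3) Z3_subBB !exprS mulnC exprM.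
ring.
Qed.

(** Partitions into parts at most [k] whose largest part l, of multiplicity f,
    satisfies f = l + t (mod 3); the next part then has to satisfy the same
    condition with t replaced by t + f. *)
Fixpoint adm_gf (k : nat) (t : 'Z_3) : R :=
  if k is k'.+1 then
    let f := (k%:R + t) in
    adm_gf k' t + (f != 0)%:R * q ^+ (k * f) * adm_gf k' (t + f)
  else 1.

Lemma adm_gfS k (t : 'Z_3) (f := k.+1%:R + t) :
  adm_gf k.+1 t
    = adm_gf k t + (f != 0)%:R * q ^+ (k.+1 * f) * adm_gf k (t + f).
Proof. by []. Qed.

Lemma adm_gfS0 k (t : 'Z_3) : k.+1%:R + t = 0 -> adm_gf k.+1 t = adm_gf k t.
Proof. by move=> e; rewrite adm_gfS e -[_ != _]/false !mul0r addr0. Qed.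

Lemma adm_gfS1 k (t : 'Z_3) :
  k.+1%:R + t = 1 -> adm_gf k.+1 t = adm_gf k t + q ^+ k.+1 * adm_gf k (t + 1).
Proof.
move=> e; rewrite adm_gfS e -[_ != _]/true mul1r; congr (_ + q ^+ _ * _).
exact: muln1.
Qed.

Lemma adm_gfS2 k (t : 'Z_3) :
  k.+1%:R + t = -1 ->
  adm_gf k.+1 t = adm_gf k t + q ^+ (2 * k.+1) * adm_gf k (t - 1).
Proof.
move=> e; rewrite adm_gfS e -[_ != _]/true mul1r; congr (_ + q ^+ _ * _).
exact: mulnC.
Qed.

(** The parts above [k] are summed in closed form, those up to [k] by [adm_gf];
    the three terms correspond to the number of parts above [k] modulo 3. *)
Definition glued_gf k :=
  let K : 'Z_3 := k%:R in
  F N.+1 (- K) k.+2 (2 * k).+2 * adm_gf k (- K)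
  + F N.+1 (1 - K) k.+1 (2 * k).+3 * adm_gf k (1 - K)
  + F N.+1 (-1 - K) k.+3 (2 * k).+4 * adm_gf k (-1 - K).

(** The part k + 1 passes from [adm_gf] to the closed form. Of the three states, one forbids it, one
    allows it once and one twice. Comparing the coefficients of each [adm_gf k t] leaves one shift
    in b and one diagonal shift. *)
Lemma glued_gfS k : glued_gf k.+1 = glued_gf k.
Proof.
have Z3E1 (K : 'Z_3) : -1 - (K + 1) = 1 - K.
  by case: K => [[|[|[|]]] ?] //; apply/val_inj.
have Z3E2 (K : 'Z_3) : K + 1 + (1 - K) = -1.
  by case: K => [[|[|[|]]] ?] //; apply/val_inj.
have S0 := @adm_gfS0 k (-1 - k%:R); have S1 := @adm_gfS1 k (- k%:R).
have S2 := @adm_gfS2 k (1 - k%:R).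
rewrite /glued_gf -!natr1 in S0 S1 S2 *.
move: (k%:R : 'Z_3) S0 S1 S2 => K S0 S1 S2.
rewrite Z3E1 (_ : 1 - (K + 1) = - K); last by ring.
rewrite (_ : - (K + 1) = -1 - K); last by ring.
rewrite S0 ?S1 ?S2 //; try by ring.
rewrite (_ : - K + 1 = 1 - K); last by ring.
rewrite (_ : 1 - K - 1 = - K); last by ring.
have e1 := word_sum_diag_lim (1 - K) k.+1.
have e2 := word_sum_shift2_lim (- K) k.+2 (2 * k).+2.
rewrite !mulnS in e1 *.
rewrite e1 e2 (_ : 1 - K - 1 = - K); last by ring.
rewrite (_ : - K + 1 = 1 - K); last by ring.
ring.
Qed.

Lemma glued_gf_large k : (N <= k)%N -> glued_gf k = adm_gf k 0.
Proof.
move=> Nk; rewrite /glued_gf !word_sum_large; try lia.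
move: (k%:R : 'Z_3) => K.
have [-> | -> | ->] : [\/ K = 0, K = 1 | K = -1].
- by case: K => [[|[|[|]]] ?] //; [apply: Or31 | apply: Or32 | apply: Or33];
    apply/val_inj.
- rewrite !subr0 oppr0 eqxx -[1 == 0]/false -[-1 == 0]/false.
  by rewrite !mul0r !addr0 mul1r.
- rewrite subrr eqxx -[- 1 == 0]/false -[-1 - 1 == 0]/false.
  by rewrite !mul0r add0r addr0 mul1r.
rewrite subrr eqxx opprK -[1 == 0]/false -[1 + 1 == 0]/false.
by rewrite !mul0r !add0r mul1r.
Qed.

(** As [glued_gf] does not depend on k, its value at k = 0, where [adm_gf] is 1, equals its value at
    large k, where the closed sums are trivial. *)
Lemma adm_gf_lim k :
  (N <= k)%N -> adm_gf k 0 = vac_poly q N.+1 + eps_poly q N.+1.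
Proof.
move=> Nk; rewrite -glued_gf_large //; elim: k {Nk} => [|k <-];
  last exact: glued_gfS.
rewrite /glued_gf mulr0n oppr0 !addr0 -![adm_gf 0 _]/1 !mulr1 /vac_poly
  /eps_poly.
(* The terms of the classes 1 and -1 at k = 0 add up to [eps_poly], by the diagonal relation at a =
   0. *)
rewrite (word_sum_diag_lim (-1) 0) mul1r.
rewrite (_ : -1 - 1 = 1 :> 'Z_3); last exact/val_inj.
by rewrite -addrA [X in _ + X]addrC.
Qed.

End Nilpotent.

(** * Alternating sums of Gaussian binomials *)

Section GaussBinomial.

Variables (R : comNzRingType) (x : R).

Fixpoint gauss (n k : nat) : R :=
  match n, k with
  | _, 0%N => 1
  | 0%N, _.+1 => 0
  | n'.+1, k'.+1 => gauss n' k' + x ^+ k * gauss n' k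
  end.

Lemma gauss0 n : gauss n 0 = 1. Proof. by case: n. Qed.

Lemma gaussS n k : gauss n.+1 k.+1 = gauss n k + x ^+ k.+1 * gauss n k.+1.
Proof. by []. Qed.

Lemma gauss_small n k : (n < k)%N -> gauss n k = 0.
Proof.
elim: n k => [|n IH] [|k] //; rewrite ltnS => nk.
by rewrite gaussS !IH ?mulr0 ?addr0 // (ltn_trans nk).
Qed.

Lemma gaussnn n : gauss n n = 1.
Proof. by elim: n => // n IH; rewrite gaussS IH gauss_small // mulr0 addr0. Qed.

Lemma gauss_absorb_next n k :
  (1 - x ^+ k.+1) * gauss n k.+1 = (1 - x ^+ (n - k)) * gauss n k.
Proof.
elim: n k => [|n IH] [|k].
- by rewrite mulr0 subrr mul0r.
- by rewrite !mulr0.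
- by rewrite gaussS mulrDr mulrCA IH !gauss0 !subn0 !exprS expr0; ring.
rewrite subSS !gaussS mulrDr mulrCA IH [RHS]mulrDr -(IH k).
have [kn|nk] := ltnP k n; last first.
  by rewrite gauss_small ?mulr0 ?addr0 ?mul0r //; lia.
rewrite (_ : (n - k = (n - k.+1).+1)%N); last lia.
rewrite !exprS; ring.
Qed.

Lemma gauss_absorb n k :
  (1 - x ^+ k.+1) * gauss n.+1 k.+1 = (1 - x ^+ n.+1) * gauss n k.
Proof.
rewrite gaussS mulrDr mulrCA gauss_absorb_next.
have [kn|nk] := leqP k n; last by rewrite gauss_small ?(mulr0, addr0).
rewrite (_ : n.+1 = k.+1 + (n - k))%N ?exprD; last lia.
ring.
Qed.

Lemma gaussS' n k :
  gauss n.+1 k.+1 = gauss n k.+1 + x ^+ (n - k) * gauss n k.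
Proof.
rewrite gaussS; apply/eqP; rewrite -subr_eq0.
rewrite (_ : _ - _ = (1 - x ^+ (n - k)) * gauss n k
  - (1 - x ^+ k.+1) * gauss n k.+1); last by ring.
by rewrite gauss_absorb_next subrr.
Qed.

Definition qpoch n : R := \prod_(i < n) (1 - x ^+ i.+1).

Lemma qpochS n : qpoch n.+1 = qpoch n * (1 - x ^+ n.+1).
Proof. exact: big_ord_recr. Qed.

Lemma gauss_qpoch k n : gauss (k + n) k * qpoch k * qpoch n = qpoch (k + n).
Proof.
elim: k => [|k IH]; first by rewrite gauss0 /qpoch big_ord0 !mul1r.
rewrite addSn !qpochS -IH.
transitivity ((1 - x ^+ k.+1) * gauss (k + n).+1 k.+1 * qpoch k * qpoch n).
  by ring.
by rewrite gauss_absorb; ring.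
Qed.

(** The Pascal rule moved onto the weights, so that recurrences between sums can be checked term by
    term against the same binomials. *)
Lemma sum_gaussS n (f : nat -> R) :
  \sum_(k < n.+2) gauss n.+1 k * f k
    = \sum_(k < n.+1) gauss n k * (x ^+ k * f k + f k.+1).
Proof.
rewrite big_ord_recl gauss0 mul1r.
under eq_bigr => k _ do rewrite lift0 gaussS mulrDl -mulrA.
under [RHS]eq_bigr => k _ do rewrite mulrDr.
rewrite !big_split /= addrCA [RHS]addrC; congr (_ + _).
rewrite big_ord_recr /= gauss_small // mul0r mulr0 addr0 [RHS]big_ord_recl.
rewrite gauss0 expr0 !mul1r; congr (_ + _); apply: eq_bigr => k _.
by rewrite lift0 mulrCA.
Qed.

Lemma sum_gaussS' n (f : nat -> R) :
  \sum_(k < n.+2) gauss n.+1 k * f k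
    = \sum_(k < n.+1) gauss n k * (f k + x ^+ (n - k) * f k.+1).
Proof.
rewrite big_ord_recl gauss0 mul1r.
under eq_bigr => k _ do rewrite lift0 gaussS' mulrDl -mulrA.
under [RHS]eq_bigr => k _ do rewrite mulrDr.
rewrite !big_split /= addrA; congr (_ + _); last first.
  by apply: eq_bigr => k _; rewrite mulrCA.
rewrite big_ord_recr /= gauss_small // mul0r addr0 [RHS]big_ord_recl.
by rewrite gauss0 mul1r.
Qed.

Lemma sum_gauss_absorb n (f : nat -> R) :
  (1 - x ^+ n.+1) * \sum_(k < n.+1) gauss n k * f k.+1
    = \sum_(k < n.+2) gauss n.+1 k * ((1 - x ^+ k) * f k).
Proof.
rewrite [RHS]big_ord_recl expr0 subrr mul0r mulr0 add0r mulr_sumr.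
apply: eq_bigr => k _; rewrite lift0 !mulrA; congr (_ * _).
by rewrite [RHS]mulrC gauss_absorb.
Qed.

Lemma sum_gauss_rev n (f : nat -> R) :
  \sum_(k < n.+1) gauss n k * f k = \sum_(k < n.+1) gauss n k * f (n - k)%N.
Proof.
elim: n f => [|n IH] f; first by rewrite !big_ord1.
rewrite sum_gaussS (sum_gaussS' n (fun k => f (n.+1 - k)%N)).
rewrite (IH (fun k => x ^+ k * f k + f k.+1)); apply: eq_bigr => k _.
have kn : (k <= n)%N by rewrite -ltnS.
by rewrite addrC subSS subSn.
Qed.

End GaussBinomial.

Arguments gauss : simpl never.

Section Bosonic.

(** Equal to N(aN + b)/2 only under the hypotheses of [quad_halfE]; otherwise
    the division is rounded and the sign is lost. *)
Definition quad_half (a b N : int) : nat := `|((N * (a * N + b)) %/ 2)%Z|%N.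

Lemma quad_halfE (a b N : int) :
  (2 %| a + b)%Z -> `|b| <= a -> (2 * quad_half a b N)%:Z = N * (a * N + b).
Proof.
move=> ab_even le_ba; rewrite /quad_half.
have e : (2 %| N * (a * N + b))%Z.
  have [k Nk] : exists k, N * (N - 1) = k * 2.
    have [m [Nm|Nm]] : exists m, N = m * 2 \/ N = m * 2 + 1.
    - by exists (N %/ 2)%Z; lia.
    - by exists (m * (m * 2 - 1)); rewrite Nm; ring.
    - by exists (m * (m * 2 + 1)); rewrite Nm; ring.
  have [l lab] := dvdzP ab_even.
  apply/dvdzP; exists (a * k + N * l).
  transitivity (a * (N * (N - 1)) + N * (a + b)); first by ring.
  by rewrite Nk lab; ring.
have ge0 : 0 <= N * (a * N + b).
  have [N0|N0] := lerP 0 N; last by nia.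
  by have [->|N1] := eqVneq N 0; [rewrite mul0r | nia].
have [l lE] := dvdzP e.
rewrite lE mulzK // in ge0 *; lia.
Qed.

(** Reduces an equality of natural exponents to a polynomial identity over the integers. *)
Lemma quad_half_shift (u v : nat) (a b a' b' N N' : int) :
  (2 %| a + b)%Z -> `|b| <= a -> (2 %| a' + b')%Z -> `|b'| <= a' ->
  2 * u%:Z + N * (a * N + b) = 2 * v%:Z + N' * (a' * N' + b') ->
  (u + quad_half a b N = v + quad_half a' b' N')%N.
Proof.
move=> ev le ev' le' e; have := quad_halfE N ev le.
have := quad_halfE N' ev' le'; lia.
Qed.

Variables (R : comNzRingType).

Definition altsign (N : int) : R := (-1) ^+ `|N|%N.

Lemma altsignN N : altsign (- N) = altsign N.
Proof. by rewrite /altsign abszN. Qed.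

Lemma altsign1 N : altsign (N + 1) = - altsign N.
Proof.
rewrite /altsign; case: N => n.
  by rewrite (_ : absz (n%:Z + 1) = n.+1) ?exprS ?mulN1r //; lia.
rewrite (_ : absz (Negz n + 1) = n); last lia.
by rewrite (_ : absz (Negz n) = n.+1) ?exprS ?mulN1r ?opprK //; lia.
Qed.

Variable q : R.
Local Notation Q := (q ^+ 3).

Definition vac_term (N : int) : R :=
  if (N %% 3)%Z == 2 then 0 else altsign N * q ^+ quad_half 5 1 N.

Definition eps_term (N : int) : R :=
  if (N %% 3)%Z == 0 then 0 else - altsign N * q ^+ quad_half 5 (- 3) N.

(** The two quadratic exponents differ by 3N - 2, of either sign; the free pair u, v avoids negative
    powers of q. The excluded residues and the signs correspond under N -> N - 1. *)
Lemma mul_vac_term u v (N : int) :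
  u%:Z = v%:Z + 3 * N - 2 -> q ^+ u * vac_term (N - 1) = q ^+ v * eps_term N.
Proof.
move=> uv; rewrite /vac_term /eps_term.
rewrite (_ : ((N - 1) %% 3 == 2)%Z = (N %% 3 == 0)%Z); last lia.
case: eqP => _; first by rewrite !mulr0.
rewrite (_ : - altsign N = altsign (N - 1)); last first.
  by rewrite -{1}[N](subrK 1) altsign1 opprK.
rewrite mulrCA [RHS]mulrCA -!exprD.
congr (_ * q ^+ _).
by apply: quad_half_shift => //; nia.
Qed.

Lemma mul_eps_term u v (N : int) :
  v%:Z = u%:Z + 3 * N + 1 -> q ^+ u * eps_term (N + 1) = q ^+ v * vac_term N.
Proof.
move=> uv; rewrite /vac_term /eps_term.
rewrite (_ : ((N + 1) %% 3 == 0)%Z = (N %% 3 == 2)%Z); last lia.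
case: eqP => _; first by rewrite !mulr0.
rewrite altsign1 opprK mulrCA [RHS]mulrCA -!exprD; congr (_ * q ^+ _).
by apply: quad_half_shift => //; nia.
Qed.

Lemma vac_term_refl u v (N : int) :
  u%:Z = v%:Z - 6 * N + 3 ->
  q ^+ u * vac_term N = - (q ^+ v * vac_term (1 - N)).
Proof.
move=> uv; rewrite /vac_term.
rewrite (_ : ((1 - N) %% 3 == 2)%Z = (N %% 3 == 2)%Z); last lia.
case: eqP => _; first by rewrite !mulr0 oppr0.
rewrite [1 - N]addrC altsign1 altsignN mulNr mulrN opprK.
rewrite mulrCA [RHS]mulrCA -!exprD; congr (_ * q ^+ _).
by apply: quad_half_shift => //; nia.
Qed.

Lemma eps_term_refl u v (N : int) :
  u%:Z = v%:Z + 3 * N -> q ^+ u * eps_term N = q ^+ v * eps_term (- N).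
Proof.
move=> uv; rewrite /eps_term.
rewrite (_ : ((- N) %% 3 == 0)%Z = (N %% 3 == 0)%Z); last lia.
case: eqP => _; first by rewrite !mulr0.
rewrite altsignN mulrCA [RHS]mulrCA -!exprD; congr (_ * q ^+ _).
by apply: quad_half_shift => //; nia.
Qed.

Definition vac_bos (M : nat) : R :=
  \sum_(k < (2 * M).+1) gauss Q (2 * M) k * vac_term (M%:Z - k%:Z).

Definition eps_bos (M : nat) : R :=
  \sum_(k < (2 * M).+2) gauss Q (2 * M).+1 k * eps_term (M.+1%:Z - k%:Z).

Hypothesis R_eqN0 : forall y : R, y = - y -> y = 0.

(** Written against the binomials of 2M + 1, the two sides differ exactly by the sum of the Q^k
    f(k). Reversal changes its sign, so it vanishes in the absence of 2-torsion. *)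
Lemma vac_bosS M :
  vac_bos M.+1 = (1 - Q ^+ (2 * M).+1) * vac_bos M
    + q ^+ 2 * Q ^+ M * eps_bos M.
Proof.
rewrite /vac_bos /eps_bos !mulnS add2n; set n := (2 * M).+1.
set f := fun k : nat => vac_term (M.+1%:Z - k%:Z).
(* The terms for N and 1 - N are opposite. *)
have anti : \sum_(k < n.+1) gauss Q n k * (Q ^+ k * f k) = 0.
  apply: R_eqN0; rewrite {1}(sum_gauss_rev _ _ (fun k => Q ^+ k * f k)) -sumrN.
  apply: eq_bigr => k _; rewrite -mulrN; congr (_ * _).
  have kn : (k <= n)%N by rewrite -ltnS.
  rewrite /f -!exprM (@vac_term_refl _ (3 * k));
    last by rewrite /n in kn *; lia.
  by congr (- (_ * vac_term _)); rewrite /n in kn *; lia.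
rewrite (sum_gaussS' _ _ f).
have -> : \sum_(k < n) gauss Q (2 * M) k * vac_term (M%:Z - k%:Z)
    = \sum_(k < n) gauss Q (2 * M) k * f k.+1.
  by apply: eq_bigr => k _; congr (_ * vac_term _); lia.
rewrite sum_gauss_absorb mulr_sumr -[LHS]subr0.
rewrite -[X in _ - X = _]anti -sumrB -big_split.
apply: eq_bigr => k _ /=; rewrite [q ^+ 2 * _ * _]mulrCA -mulrDr -mulrBr;
  congr (_ * _).
have kn : (k <= n)%N by rewrite -ltnS.
have e : Q ^+ (n - k) * f k.+1 = q ^+ 2 * Q ^+ M * eps_term (M.+1%:Z - k%:Z).
  rewrite -!exprM -exprD -(@mul_vac_term (3 * (n - k)));
    last by rewrite /n in kn *; lia.
  by congr (_ * vac_term _); lia.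
by rewrite e; ring.
Qed.

(** A first Pascal rule splits off the [vac_bos] term. A second one leaves two sums over the same
    binomials, and the reflection N -> - N shows that the second is Q^(M+1) times the first. *)
Lemma eps_bosS M :
  eps_bos M.+1
    = (1 + Q ^+ M.+1) * eps_bos M + q * Q ^+ M.+1 * vac_bos M.+1.
Proof.
rewrite /vac_bos /eps_bos !mulnS add2n; set n := (2 * M).+1.
set f := fun k : nat => eps_term (M.+1%:Z - k%:Z).
pose g (k : nat) := eps_term (M.+2%:Z - k%:Z).
rewrite (sum_gaussS _ _ g).
under eq_bigr => k _ do rewrite mulrDr.
rewrite big_split /= addrC; congr (_ + _); last first.
  rewrite mulr_sumr; apply: eq_bigr => k _; rewrite [RHS]mulrCA; congr (_ * _).
  have kn : (k <= n.+1)%N by rewrite -ltnS.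
  rewrite -!exprM -exprS -(@mul_eps_term (3 * k));
    last by rewrite /n in kn *; lia.
  by congr (_ * eps_term _); lia.
transitivity (\sum_(k < n.+2) gauss Q n.+1 k * f k).
  by apply: eq_bigr => k _; congr (_ * eps_term _); lia.
rewrite (sum_gaussS' _ n f) mulrDl mul1r.
under [LHS]eq_bigr => k _ do rewrite mulrDr.
rewrite big_split /=; congr (_ + _).
rewrite [in RHS](sum_gauss_rev _ _ f) mulr_sumr; apply: eq_bigr => k _.
rewrite [RHS]mulrCA; congr (_ * _).
have kn : (k <= n)%N by rewrite -ltnS.
rewrite -!exprM (@eps_term_refl _ (3 * M.+1)); last by rewrite /n in kn *; lia.
by congr (_ * eps_term _); rewrite /n in kn *; lia.
Qed.

(** Induction on the pair (Y_M, X_(M+1)); the index of X is shifted because [eps_bos M] uses the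
    binomials of 2M + 1 = 2(M+1) - 1. *)
Lemma poly_bosE M :
  vac_poly q M = vac_bos M /\ eps_poly q M.+1 = eps_bos M.
Proof.
have v0 : vac_poly q 0 = vac_bos 0.
  rewrite /vac_bos big_ord1 gauss0 subrr /vac_term /altsign /quad_half.
  by rewrite mod0z mul0r div0z /= !mul1r.
have v1 : vac_bos 0 = 1 by rewrite -v0.
have e0 : eps_poly q 1 = eps_bos 0.
  rewrite eps_polyS v0 v1 (_ : eps_poly q 0 = 0) // mulr0 add0r expr0 !mulr1.
  rewrite /eps_bos big_ord_recl big_ord1 lift0 gauss0 gaussnn !mul1r.
  rewrite subr0 subrr /eps_term /altsign /quad_half /= expr1 opprK addr0 mul1r.
  exact: esym (expr1 q).
elim: M => [|M [IHv IHe]]; first by rewrite v0.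
split; first by rewrite vac_polyS vac_bosS IHv IHe.
by rewrite eps_polyS eps_bosS vac_polyS vac_bosS IHv IHe.
Qed.

End Bosonic.

(** * Jacobi's triple product and limits *)

Section TripleProduct.

Variables (R : comNzRingType) (t : R) (r : nat).
Hypothesis r_le15 : (r <= 15)%N.

Definition theta_term (N : int) : R :=
  altsign R N * t ^+ quad_half 15 (15 - 2 * r%:Z) N.

Definition theta_prod (m : nat) : R :=
  \prod_(i < m) ((1 - t ^+ (15 * i + r)) * (1 - t ^+ (15 * i + (15 - r)))).

Lemma mul_theta_term u v (N : int) :
  u%:Z = v%:Z + 15 * N - r%:Z ->
  t ^+ u * theta_term (N - 1) = - (t ^+ v * theta_term N).
Proof.
move=> uv; rewrite /theta_term (_ : altsign R N = - altsign R (N - 1));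
  last first.
  by rewrite -{1}[N](subrK 1) altsign1.
rewrite mulNr mulrN opprK mulrCA [RHS]mulrCA -!exprD; congr (_ * t ^+ _).
by apply: quad_half_shift; lia.
Qed.

(** Finite form of Jacobi's identity. Passing from m to m + 1 brings two new factors, each split off
    by one of the two Pascal rules. *)
Lemma triple_product m :
  theta_prod m
    = \sum_(k < (2 * m).+1)
        gauss (t ^+ 15) (2 * m) k * theta_term (m%:Z - k%:Z).
Proof.
elim: m => [|m IH].
  rewrite /theta_prod big_ord0 big_ord1 subrr gauss0 /theta_term /altsign
    /quad_half.
  by rewrite mul0r div0z !mul1r.
rewrite /theta_prod big_ord_recr /= -/(theta_prod m) mulnS add2n.
set n := (2 * m).+1; pose f (k : nat) := theta_term (m.+1%:Z - k%:Z).
rewrite (sum_gaussS' _ n f).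
transitivity ((1 - t ^+ (15 * m + r))
  * \sum_(k < n.+1) gauss (t ^+ 15) n k * f k).
  rewrite mulrCA; congr (_ * _).
  rewrite (sum_gaussS _ _ f) {}IH mulr_suml; apply: eq_bigr => k _.
  rewrite -mulrA; congr (_ * _).
  have e := @mul_theta_term (15 * m + (15 - r)) (15 * k) (m.+1%:Z - k%:Z).
  rewrite exprM in e.
  rewrite (_ : f k.+1 = theta_term (m%:Z - k%:Z)); last first.
    by congr theta_term; lia.
  rewrite -[(t ^+ 15) ^+ k * f k]opprK -e; last lia.
  rewrite (_ : m.+1%:Z - k%:Z - 1 = m%:Z - k%:Z); last lia.
  by ring.
rewrite mulr_sumr; apply: eq_bigr => k _; rewrite mulrCA; congr (_ * _).
have kn : (k <= n)%N by rewrite -ltnS.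
have e := @mul_theta_term (15 * (n - k)) (15 * m + r) (m.+1%:Z - k%:Z).
rewrite exprM (_ : m.+1%:Z - k%:Z - 1 = m.+1%:Z - k.+1%:Z) in e; last lia.
by rewrite e; [rewrite /f; ring | rewrite /n in kn *; lia].
Qed.

End TripleProduct.

Section NilpotentLimits.

Variables (R : comNzRingType) (N : nat).

Lemma one_sub_nilp_inv (z : R) : z ^+ N = 0 -> exists y, (1 - z) * y = 1.
Proof.
move=> zN; exists (\sum_(i < N) z ^+ i).
by rewrite -opprB mulNr -subrX1 zN sub0r opprK.
Qed.

Lemma prod_inv (I : Type) (s : seq I) (P : pred I) (F : I -> R) :
  (forall i, exists y, F i * y = 1) ->
  exists y, (\prod_(i <- s | P i) F i) * y = 1.
Proof.
move=> Finv; elim/big_rec: _ => [|i x _ [y xy]].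
  by exists 1; rewrite mulr1.
have [z Fz] := Finv i; exists (z * y).
by rewrite mulrACA Fz xy mulr1.
Qed.

Variables (x : R).
Hypothesis xN : x ^+ N = 0.

Lemma one_sub_exp_inv i : exists y, (1 - x ^+ i.+1) * y = 1.
Proof. by apply: one_sub_nilp_inv; rewrite -exprM mulnC exprM xN expr0n. Qed.

Lemma qpoch_inv n : exists y, qpoch x n * y = 1.
Proof. by apply: prod_inv => i; apply: one_sub_exp_inv. Qed.

Lemma qpoch_cancel n : injective ( *%R (qpoch x n)).
Proof.
have [y e] := qpoch_inv n; move=> a b ab.
by rewrite -[a]mul1r -[b]mul1r -e [_ * y]mulrC -!mulrA ab.
Qed.

Lemma qpoch_stable M : (N <= M)%N -> qpoch x M = qpoch x N.
Proof.
elim: M => [|M IH]; first by rewrite leqn0 => /eqP ->.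
rewrite leq_eqVlt => /predU1P[->//|NM].
by rewrite qpochS (exp_nilp xN) ?subr0 ?mulr1 ?IH // ltnW.
Qed.

(** The binomial is (x)_n / ((x)_k (x)_(n-k)), and all three products have reached their stable
    value (x)_N. *)
Lemma gauss_lim n k :
  (N + k <= n)%N -> (N <= k)%N -> qpoch x N * gauss x n k = 1.
Proof.
move=> Nkn Nk; have kn : (k <= n)%N by exact: leq_trans (leq_addl _ _) Nkn.
have := gauss_qpoch x k (n - k); rewrite subnKC // !qpoch_stable //; try lia.
by move=> e; apply: (@qpoch_cancel N); rewrite mulr1 -[RHS]e; ring.
Qed.

(** A term with f(c - k) nonzero has |c - k| < N; the bounds on c then force both k and n - k to be
    at least N, where the binomial is at its limit. *)
Lemma sum_gauss_lim n (c : int) (f : int -> R) :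
  (forall i : int, (N%:Z <= `|i|) -> f i = 0) ->
  (2 * N)%:Z <= c -> c + (2 * N)%:Z <= n%:Z ->
  qpoch x N * (\sum_(k < n.+1) gauss x n k * f (c - k%:Z))
    = \sum_(k < n.+1) f (c - k%:Z).
Proof.
move=> f0 le_c c_le; rewrite mulr_sumr; apply: eq_bigr => k _; rewrite mulrA.
have [Nk|kN] := leqP N k; last by rewrite f0 ?mulr0 //; lia.
have [kNn|nkN] := leqP (N + k) n; first by rewrite gauss_lim // mul1r.
by rewrite f0 ?mulr0 //; lia.
Qed.

End NilpotentLimits.

Lemma sum_blocks3 (V : nmodType) n (f : nat -> V) :
  \sum_(k < 3 * n) f k
    = \sum_(j < n) (f (3 * j)%N + f (3 * j).+1 + f (3 * j).+2).
Proof.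
elim: n => [|n IH]; first by rewrite muln0 !big_ord0.
by rewrite mulnS !big_ord_recr /= IH !addrA.
Qed.

Section BosonicLimits.

Variables (R : comNzRingType) (q : R) (N : nat).
Hypothesis qN : q ^+ N = 0.
Local Notation Q := (q ^+ 3).

(** As n^2 >= |n|, the exponent is at least (a - |b|) |n| / 2, whence the gap of 2 between a and
    |b|. *)
Lemma quad_half_ge (a b n : int) :
  (2 %| a + b)%Z -> `|b| + 2 <= a -> `|n| <= (quad_half a b n)%:Z.
Proof.
move=> ev le; have le' : `|b| <= a by lia.
have := quad_halfE n ev le'.
have [n0|n0] := lerP 0 n; nia.
Qed.

Lemma exp_quad_half (a b n : int) :
  (2 %| a + b)%Z -> `|b| + 2 <= a -> N%:Z <= `|n| -> q ^+ quad_half a b n = 0.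
Proof.
move=> ev le Nn; apply: (exp_nilp qN).
by have := quad_half_ge n ev le; lia.
Qed.

Lemma vac_term_large (n : int) : N%:Z <= `|n| -> vac_term q n = 0.
Proof. by move=> Nn; rewrite /vac_term exp_quad_half // mulr0 if_same. Qed.

Lemma eps_term_large (n : int) : N%:Z <= `|n| -> eps_term q n = 0.
Proof. by move=> Nn; rewrite /eps_term exp_quad_half // mulr0 if_same. Qed.

Lemma Q_nilp : Q ^+ N = 0.
Proof. by rewrite -exprM mulnC exprM qN expr0n. Qed.

Lemma altsign3 n : altsign R (3 * n) = altsign R n.
Proof.
rewrite /altsign abszM exprM; congr (_ ^+ _).
by rewrite !exprS expr0; ring.
Qed.

Lemma quad_half_scale (u : nat) (a b a' b' n n' : int) :
  (2 %| a + b)%Z -> `|b| <= a -> (2 %| a' + b')%Z -> `|b'| <= a' ->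
  n * (a * n + b) = 2 * u%:Z + 3 * (n' * (a' * n' + b')) ->
  quad_half a b n = (u + 3 * quad_half a' b' n')%N.
Proof.
move=> ev le ev' le' e; have := quad_halfE n ev le.
have := quad_halfE n' ev' le'; lia.
Qed.

(** First case of the dissection of the index modulo 3. Each surviving exponent is a constant plus 3
    n (15 n + 15 - 2r) / 2, up to the sign of n, and its linear coefficient determines r. *)
Lemma vac_term0 n : vac_term q (3 * n) = theta_term Q 7 n.
Proof.
rewrite /vac_term /theta_term (_ : (3 * n %% 3)%Z = 0) /=; last lia.
rewrite altsign3 -exprM; congr (_ * q ^+ _).
by apply: (@quad_half_scale 0) => //; nia.
Qed.

Lemma vac_term1 n : vac_term q (3 * n + 1) = - (Q * theta_term Q 2 n).
Proof.
rewrite /vac_term /theta_term (_ : ((3 * n + 1) %% 3)%Z = 1) /=; last lia.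
rewrite altsign1 altsign3 mulrCA -exprM -exprD -mulNr; congr (_ * q ^+ _).
by apply: (@quad_half_scale 3) => //; nia.
Qed.

Lemma vac_term2 n : vac_term q (3 * n - 1) = 0.
Proof. by rewrite /vac_term (_ : ((3 * n - 1) %% 3)%Z = 2) //; lia. Qed.

Lemma eps_term1 n : eps_term q (3 * n + 1) = q * theta_term Q 4 n.
Proof.
rewrite /eps_term /theta_term (_ : ((3 * n + 1) %% 3)%Z = 1) /=; last lia.
rewrite altsign1 altsign3 opprK mulrCA -exprM -exprS; congr (_ * q ^+ _).
by apply: (@quad_half_scale 1) => //; nia.
Qed.

Lemma eps_term0 n : eps_term q (3 * n) = 0.
Proof. by rewrite /eps_term (_ : (3 * n %% 3)%Z = 0) //; lia. Qed.

Lemma eps_term2 n : eps_term q (3 * n - 1) = q * (Q * theta_term Q 1 (- n)).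
Proof.
rewrite /eps_term /theta_term (_ : ((3 * n - 1) %% 3)%Z = 2) /=; last lia.
rewrite (_ : 3 * n - 1 = - (3 * (- n) + 1)); last by ring.
rewrite altsignN altsign1 altsign3 opprK mulrA -exprS mulrCA -exprM -exprD.
congr (_ * q ^+ _); by apply: (@quad_half_scale 4) => //; nia.
Qed.

Definition theta_sum r m : R :=
  \sum_(j < (2 * m).+1) theta_term Q r (m%:Z - j%:Z).

Lemma theta_sum_prod r m :
  (0 < r < 15)%N -> (2 * N <= m)%N ->
  qpoch (Q ^+ 15) N * theta_prod Q r m = theta_sum r m.
Proof.
move=> /andP[r0 r15] Nm; rewrite triple_product; last exact: ltnW.
have Q15 : (Q ^+ 15) ^+ N = 0 by rewrite -exprM mulnC exprM Q_nilp expr0n.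
rewrite (sum_gauss_lim Q15) //; try lia.
move=> n Nn; rewrite /theta_term -exprM; rewrite (exp_nilp qN) ?mulr0 //.
have := @quad_half_ge 15 (15 - 2 * r%:Z) n; lia.
Qed.

Lemma vac_bos_lim m :
  (N <= m)%N ->
  qpoch Q N * vac_bos q (3 * m).+1 = theta_sum 7 m - Q * theta_sum 2 m.
Proof.
move=> Nm; rewrite /vac_bos (sum_gauss_lim Q_nilp vac_term_large); try lia.
(* The index [(3 * m).+1] makes the number of terms divisible by 3; block j then holds the indices
   3n + 1, 3n, 3n - 1 with n = m - j. *)
rewrite (_ : (2 * (3 * m).+1).+1 = 3 * (2 * m).+1)%N; last lia.
rewrite (sum_blocks3 _ (fun k : nat => vac_term q ((3 * m).+1%:Z - k%:Z))).
rewrite mulr_sumr -sumrB; apply: eq_bigr => j _.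
rewrite (_ : (3 * m).+1%:Z - (3 * j)%N%:Z = 3 * (m%:Z - j%:Z) + 1); last lia.
rewrite (_ : (3 * m).+1%:Z - (3 * j).+1%:Z = 3 * (m%:Z - j%:Z)); last lia.
rewrite (_ : (3 * m).+1%:Z - (3 * j).+2%:Z = 3 * (m%:Z - j%:Z) - 1); last lia.
by rewrite vac_term0 vac_term1 vac_term2 addr0 addrC.
Qed.

Lemma eps_bos_lim m :
  (N <= m)%N ->
  qpoch Q N * eps_bos q (3 * m).+1 = q * (theta_sum 4 m + Q * theta_sum 1 m).
Proof.
move=> Nm; rewrite /eps_bos (sum_gauss_lim Q_nilp eps_term_large); try lia.
(* There is one term too many for blocks of three; the first has index 3m + 2 >= N and vanishes. *)
rewrite big_ord_recl eps_term_large ?add0r; last by rewrite /=; lia.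
rewrite (_ : (2 * (3 * m).+1).+1 = 3 * (2 * m).+1)%N; last lia.
rewrite (eq_bigr (fun k : 'I__ => eps_term q ((3 * m).+1%:Z - k%:Z)));
  last first.
  by move=> k _; congr eps_term; rewrite lift0; lia.
rewrite (sum_blocks3 _ (fun k : nat => eps_term q ((3 * m).+1%:Z - k%:Z))).
(* The dissection produces this theta series at - n; the range of summation is symmetric. *)
have -> : theta_sum 1 m
    = \sum_(j < (2 * m).+1) theta_term Q 1 (- (m%:Z - j%:Z)).
  rewrite /theta_sum (reindex_inj rev_ord_inj); apply: eq_bigr => j _ /=.
  by congr theta_term; have := ltn_ord j; lia.
rewrite [Q * _]mulr_sumr -big_split mulr_sumr; apply: eq_bigr => j _ /=.
rewrite (_ : (3 * m).+1%:Z - (3 * j)%N%:Z = 3 * (m%:Z - j%:Z) + 1); last lia.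
rewrite (_ : (3 * m).+1%:Z - (3 * j).+1%:Z = 3 * (m%:Z - j%:Z)); last lia.
rewrite (_ : (3 * m).+1%:Z - (3 * j).+2%:Z = 3 * (m%:Z - j%:Z) - 1); last lia.
by rewrite eps_term0 eps_term1 eps_term2 addr0 mulrDr.
Qed.

End BosonicLimits.

(** * Products over residue classes modulo 15 *)

Definition avoids (r m : nat) : bool := (m %% 15)%N \notin [:: 0; r; 15 - r]%N.

Definition avoid_prod {R : comNzRingType} (x : R) (r n : nat) : R :=
  \prod_(i < n) (if avoids r i.+1 then 1 - x ^+ i.+1 else 1).

Lemma prod_block15 (R : comNzRingType) (F : nat -> R) m :
  \prod_(i < 15 * m.+1) F i
    = (\prod_(i < 15 * m) F i) * \prod_(j < 15) F (15 * m + j)%N.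
Proof. by rewrite mulnSr big_split_ord. Qed.

Lemma avoids_block r m j : avoids r (15 * m + j).+1 = avoids r j.+1.
Proof. by rewrite /avoids -addnS mulnC modnMDl. Qed.

(** The factors are sorted by residue: multiples of 15, then r and 15 - r, then the rest. For the
    listed r these classes are distinct. *)
Lemma qpoch_avoid_prod (R : comNzRingType) (x : R) r m :
  r \in [:: 1; 2; 4; 7]%N ->
  qpoch x (15 * m)
    = qpoch (x ^+ 15) m * theta_prod x r m * avoid_prod x r (15 * m).
Proof.
move=> r_in; elim: m => [|m IH].
  by rewrite /qpoch /theta_prod /avoid_prod muln0 !big_ord0 !mul1r.
have -> : qpoch x (15 * m.+1)
    = qpoch x (15 * m) * \prod_(j < 15) (1 - x ^+ (15 * m + j).+1).
  exact: (prod_block15 (fun i => 1 - x ^+ i.+1)).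
have -> : avoid_prod x r (15 * m.+1) = avoid_prod x r (15 * m) *
    \prod_(j < 15) (if avoids r j.+1 then 1 - x ^+ (15 * m + j).+1 else 1).
  rewrite /avoid_prod (prod_block15 (fun i =>
    if avoids r i.+1 then 1 - x ^+ i.+1 else 1)).
  by congr (_ * _); apply: eq_bigr => j _; rewrite avoids_block.
rewrite qpochS /theta_prod [\prod_(i < m.+1) _]big_ord_recr.
rewrite -/(theta_prod x r m) IH.
rewrite -exprM mulnS addnC.
rewrite !big_ord_recr !big_ord0 /= !mul1r.
move: r_in; rewrite !inE => /or4P[] /eqP -> /=; rewrite ?addnS ?addn0.
all: ring.
Qed.

(** * Enumeration of partitions by multiplicities *)

Section Enumeration.

Local Open Scope nat_scope.

Variables (S : Type) (ms : nat -> S -> pred nat) (nx : S -> nat -> S).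

Definition parts_in (L : nat) (p : seq nat) : bool :=
  sorted geq p && all (fun x => 0 < x <= L) p.

(* [ms l s] is the set of multiplicities allowed for the part [l] in the state
   [s], and [nx s f] the state after the choice of the multiplicity [f]. *)
Fixpoint mult_ok (L : nat) (s : S) (p : seq nat) : bool :=
  if L is L'.+1 then
    let f := count_mem L p in ms L s f && mult_ok L' (nx s f) p
  else true.

Fixpoint enum_parts (L : nat) (s : S) (n : nat) : seq (seq nat) :=
  if L is L'.+1 then
    flatten [seq [seq nseq f L ++ p | p <- enum_parts L' (nx s f) (n - f * L)]
            | f <- iota 0 n.+1 & ms L s f && (f * L <= n)]
  else if n == 0 then [:: [::]] else [::].

Lemma enum_partsS L s n :
  enum_parts L.+1 s n =
    flatten [seq [seq nseq f L.+1 ++ p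
              | p <- enum_parts L (nx s f) (n - f * L.+1)]
            | f <- iota 0 n.+1 & ms L.+1 s f && (f * L.+1 <= n)].
Proof. by []. Qed.

Lemma mult_okS L s p (f := count_mem L.+1 p) :
  mult_ok L.+1 s p = ms L.+1 s f && mult_ok L (nx s f) p.
Proof. by []. Qed.

Lemma eq_mult_ok L s p p' :
  (forall l, 0 < l <= L -> count_mem l p = count_mem l p') ->
  mult_ok L s p = mult_ok L s p'.
Proof.
elim: L s => //= L IH s cE; rewrite cE ?ltnSn // IH // => l /andP[l0 lL].
by rewrite cE // l0 ltnW.
Qed.

Lemma parts_inS L p :
  parts_in L.+1 p ->
  exists2 p', parts_in L p' & p = nseq (count_mem L.+1 p) L.+1 ++ p'.
Proof.
elim: p => [|x p IH]; first by exists [::].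
rewrite /parts_in /= => /andP[sxp /andP[/andP[x0 xL] pL]].
have sp := path_sorted sxp.
case: (ltngtP x L.+1) xL => // [xL _|-> _].
  have x_max : all (geq x) p by apply: order_path_min sxp => a b c; lia.
  have -> : count_mem L.+1 p = 0.
    apply/eqP; rewrite -leqn0 leqNgt -has_count -all_predC;
      apply/allP => y yp /=.
    by have := allP x_max _ yp; rewrite /geq /=; lia.
  exists (x :: p) => //; rewrite /parts_in /= sxp x0 -ltnS xL /=.
  apply/allP => y yp; have := allP x_max _ yp; have := allP pL _ yp.
  by rewrite /geq /=; lia.
have [|p' p'L pE] := IH; first by rewrite /parts_in sp pL.
by exists p' => //; rewrite add1n {1}pE.
Qed.

Lemma count_nseq_cat L f p l :
  parts_in L p -> l <= L.+1 ->
  count_mem l (nseq f L.+1 ++ p) = if l == L.+1 then f else count_mem l p.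
Proof.
move=> /andP[_ pL] lL; rewrite count_cat count_nseq /= eq_sym.
case: eqVneq => [->|_]; last by rewrite mul0n.
rewrite mul1n -[RHS]addn0; congr (_ + _); apply/eqP.
rewrite -leqn0 leqNgt -has_count -all_predC; apply/allP => y yp /=.
by have := allP pL _ yp; lia.
Qed.

Lemma parts_in_nseq_cat L f p :
  parts_in L p -> parts_in L.+1 (nseq f L.+1 ++ p).
Proof.
move=> /andP[sp pL]; rewrite /parts_in all_cat all_nseq ltnSn orbT /=.
apply/andP; split; last by apply: sub_all pL => y; lia.
elim: f => [//|f IH] /=; rewrite path_min_sorted //.
rewrite all_cat all_nseq /geq /= leqnn orbT /=.
by apply: sub_all pL => y /=; lia.
Qed.

Lemma mem_enum_parts L s n p :
  (p \in enum_parts L s n) = [&& parts_in L p, sumn p == n & mult_ok L s p].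
Proof.
elim: L s n p => [|L IH] s n p.
  rewrite /parts_in /=; case: p => [|x p] /=.
    by rewrite eq_sym; case: eqP.
  rewrite [x <= 0]leqNgt andbN andbF /=.
  by case: eqP.
rewrite enum_partsS mult_okS; apply/flatten_mapP/and3P =>
  [[f]|[pL /eqP pn /andP[msf ok]]].
  rewrite mem_filter => /andP[/andP[msf fn] _] /mapP[p' + ->].
  rewrite IH => /and3P[p'L /eqP p'n ok]; split.
  - exact: parts_in_nseq_cat.
  - by rewrite sumn_cat sumn_nseq p'n mulnC subnKC // mulnC.
  rewrite count_nseq_cat // eqxx msf /=.
  rewrite (eq_mult_ok _ (p' := p')) // => l lL.
  by rewrite count_nseq_cat //; [case: eqP; lia | lia].
have [p' p'L pE] := parts_inS pL; set f := count_mem L.+1 p in msf ok pE.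
have sE : f * L.+1 + sumn p' = n by rewrite -pn pE sumn_cat sumn_nseq mulnC.
exists f; first by rewrite mem_filter msf mem_iota /=; nia.
apply/mapP; exists p' => //; rewrite IH p'L -sE addKn eqxx /=.
rewrite -(eq_mult_ok _ (p := p)) // => l lL.
by rewrite pE count_nseq_cat //; [case: eqP; lia | lia].
Qed.

Lemma uniq_enum_parts L s n : uniq (enum_parts L s n).
Proof.
elim: L s n => [|L IH] s n; first by rewrite /=; case: eqP.
rewrite enum_partsS; apply: allpairs_uniq_dep => [|f _|].
- by rewrite filter_uniq ?iota_uniq.
- exact: IH.
move=> [f p] [g p'] /allpairsPdep[f0 [p0 [_ + [-> ->]]]].
rewrite mem_enum_parts => /and3P[pL _ _] /allpairsPdep[g0 [p0' [_ + [-> ->]]]].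
rewrite mem_enum_parts => /and3P[p'L _ _] /= e.
have fg : f0 = g0.
  have := congr1 (count_mem L.+1) e.
  by rewrite !count_nseq_cat // eqxx.
rewrite fg in e *; congr existT.
by have := congr1 (drop g0) e; rewrite !drop_size_cat ?size_nseq.
Qed.

(** The bound B replaces n + 1 so that the range of f is the same for all n and the sums over n and
    f can be exchanged. *)
Lemma size_enum_partsS L s n B :
  n < B ->
  size (enum_parts L.+1 s n) =
    \sum_(f < B | ms L.+1 s f && (f * L.+1 <= n))
      size (enum_parts L (nx s f) (n - f * L.+1)).
Proof.
move=> nB; rewrite enum_partsS size_flatten sumnE !big_map big_filter.
pose F f := size (enum_parts L (nx s f) (n - f * L.+1)).
rewrite -[iota _ _]/(index_iota 0 n.+1) (eq_bigr F); last first.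
  by move=> f _; rewrite size_map.
rewrite (big_mkord (fun f => ms L.+1 s f && (f * L.+1 <= n))).
rewrite (big_ord_widen_cond _ (fun f => ms L.+1 s f && (f * L.+1 <= n)) F nB).
apply: eq_bigl => f.
by rewrite -andbA; case: (ms _ _ _) => //=; apply/idP/idP; nia.
Qed.

End Enumeration.

Section EnumerationSeries.

Variables (S : Type) (ms : nat -> S -> pred nat) (nx : S -> nat -> S).
Variables (R : comNzRingType) (N : nat) (x : R).
Hypothesis xN : x ^+ N = 0.

Definition enum_gf (L : nat) (s : S) : R :=
  \sum_(n < N) (size (enum_parts ms nx L s n))%:R * x ^+ n.

Lemma enum_gf0 s : enum_gf 0 s = 1.
Proof.
rewrite /enum_gf; case: N xN => [/eqP|M _]; first by rewrite expr0 oner_eq0.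
by rewrite big_ord_recl big1 ?addr0 /= ?mulr1 // => i _; rewrite mul0r.
Qed.

(** The terms on the right that have no counterpart on the left have degree at least N. *)
Lemma sum_shift_nilp (c : nat -> R) d :
  \sum_(n < N | (d <= n)%N) c (n - d)%N * x ^+ n
    = x ^+ d * \sum_(n < N) c n * x ^+ n.
Proof.
rewrite -(big_mkord (fun n => d <= n)%N (fun n => c (n - d)%N * x ^+ n)).
rewrite -(big_mkord xpredT (fun n => c n * x ^+ n)).
have [Nd|dN] := leqP N d.
  rewrite (exp_nilp xN) // mul0r big_nat_cond big_pred0 // => n.
  by apply/negbTE; lia.
rewrite (big_cat_nat (leq0n d) (ltnW dN)) //= big_nat_cond big_pred0 ?add0r;
  last first.
  by move=> n; apply/negbTE; lia.
rewrite (big_cat_nat (leq0n (N - d)) (leq_subr d N)) /= mulrDr.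
rewrite [X in _ = _ + _ * X]big_nat [X in _ = _ + X]mulr_sumr.
rewrite [X in _ = _ + X]big1 ?addr0; last first.
  by move=> n nN; rewrite mulrCA -exprD (exp_nilp xN) ?mulr0 //; lia.
rewrite -{1}[d]add0n big_addn mulr_sumr; apply: eq_big => [n|n _].
  by lia.
by rewrite addnK exprD mulrCA mulrC mulrA [c n * _]mulrC.
Qed.

Lemma enum_gfS L s :
  enum_gf L.+1 s
    = \sum_(f < N | ms L.+1 s f) x ^+ (f * L.+1) * enum_gf L (nx s f).
Proof.
rewrite /enum_gf.
under eq_bigr => n _ do
  rewrite (size_enum_partsS _ _ _ _ (ltn_ord n)) natr_sum mulr_suml.
rewrite (exchange_big_dep (fun f : 'I_N => ms L.+1 s f)) /=; last first.
  by move=> n f _ /andP[].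
apply: eq_bigr => f msf.
rewrite -(sum_shift_nilp (fun n => (size (enum_parts ms nx L (nx s f) n))%:R)).
by apply: eq_bigl => n; rewrite msf.
Qed.

End EnumerationSeries.

Arguments enum_parts : simpl never.

Lemma parts_inP (L n : nat) p :
  (n <= L)%N ->
  parts_in L p && (sumn p == n) = is_partition n%:Z p.
Proof.
move=> nL; rewrite /parts_in /is_partition eqz_nat -!andbA; congr (_ && _).
apply/andP/andP => [[pL pn]|[p0 pn]]; split=> //.
  by apply/negP => /(allP pL).
apply/allP => x xp; rewrite lt0n (leq_trans (part_le_sumn xp)) ?(eqP pn) //
  andbT.
by apply: contraNneq p0 => <-.
Qed.

Lemma num_partitions_enum (S : Type) ms nx (s : S) (L n : nat) P :
  (n <= L)%N -> (forall p, parts_in L p -> P p = mult_ok ms nx L s p) ->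
  num_partitions n%:Z P = size (enum_parts ms nx L s n).
Proof.
move=> nL PE; apply: num_partitionsE; first exact: uniq_enum_parts.
move=> p; rewrite mem_enum_parts -(parts_inP p nL) -andbA.
have [pL|//] := boolP (parts_in L p).
by rewrite PE.
Qed.

Lemma num_partitions_neg (n : int) P : n < 0 -> num_partitions n P = 0%N.
Proof.
move=> n0; apply: (@num_partitionsE _ _ [::]) => // p.
by rewrite /is_partition (_ : (sumn p)%:Z == n = false) ?andbF //; lia.
Qed.

Definition avoid_mult (r m : nat) (_ : unit) : pred nat :=
  fun f => (f == 0)%N || avoids r m.

Definition avoid_next (s : unit) (_ : nat) : unit := s.

Lemma mult_ok_nseq_cat (S : Type) ms nx L (s : S) f p :
  parts_in L p ->
  mult_ok ms nx L.+1 s (nseq f L.+1 ++ p)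
    = ms L.+1 s f && mult_ok ms nx L (nx s f) p.
Proof.
move=> pL; rewrite mult_okS count_nseq_cat // eqxx; congr (_ && _).
by apply: eq_mult_ok => l lL; rewrite count_nseq_cat //; [case: eqP; lia | lia].
Qed.

Lemma avoids_mult_ok r L p :
  parts_in L p -> all (avoids r) p = mult_ok (avoid_mult r) avoid_next L tt p.
Proof.
elim: L p => [|L IH] p pL.
  by case: p pL => [|x p] //=; rewrite /parts_in /=; lia.
have [p' p'L ->] := parts_inS pL.
by rewrite mult_ok_nseq_cat // all_cat all_nseq -IH.
Qed.

Lemma parts_avoidE r p :
  r \in [:: 1; 2; 4; 7]%N -> parts_avoid r p = all (avoids r) p.
Proof.
move=> r_in; apply: eq_all => x; rewrite /avoids !inE.
by move: r_in; rewrite !inE => /or4P[] /eqP ->; lia.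
Qed.

Lemma num_partitions_avoid r (L n : nat) :
  r \in [:: 1; 2; 4; 7]%N -> (n <= L)%N ->
  num_partitions n%:Z (parts_avoid r)
    = size (enum_parts (avoid_mult r) avoid_next L tt n).
Proof.
move=> r_in nL; apply: num_partitions_enum => // p pL.
by rewrite parts_avoidE // (avoids_mult_ok _ pL).
Qed.

Lemma nilp_order_gt0 (R : comNzRingType) (x : R) N : x ^+ N = 0 -> (0 < N)%N.
Proof. by case: N => // /eqP; rewrite expr0 oner_eq0. Qed.

(** Each allowed size l contributes a geometric series, truncated at N terms and still inverse to 1
    - x^l by nilpotency. *)
Lemma avoid_gf (R : comNzRingType) (x : R) N r L :
  x ^+ N = 0 ->
  enum_gf (avoid_mult r) avoid_next N x L tt * avoid_prod x r L = 1.
Proof.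
move=> xN; elim: L => [|L IH].
  by rewrite enum_gf0 // /avoid_prod big_ord0 mulr1.
rewrite /avoid_prod big_ord_recr /= -/(avoid_prod x r L) enum_gfS //.
rewrite (eq_bigr (fun f : 'I_N => x ^+ (f * L.+1) *
  enum_gf (avoid_mult r) avoid_next N x L tt)) // -mulr_suml.
rewrite [avoid_mult _ _ _]/avoid_mult; case: ifP => av; last first.
  have N0 := nilp_order_gt0 xN.
  rewrite (big_pred1 (Ordinal N0)) => [|f];
    first by rewrite mul0n expr0 mul1r mulr1.
  by rewrite orbF.
rewrite (eq_bigl xpredT) => [|f]; last by rewrite orbT.
rewrite [X in X * _]mulrC mulrACA IH mul1r mulrC -opprB mulNr.
under eq_bigr => f _ do rewrite mulnC exprM.
by rewrite -subrX1 -exprM mulnC exprM xN expr0n sub0r opprK.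
Qed.

(** Multiplicity 0 means that m is not a part. A positive one is below 3 and congruent to m + s, so
    it equals the representative of that class in {0, 1, 2}. *)
Definition adm_mult (m : nat) (s : 'Z_3) : pred nat :=
  fun f => (f == 0)%N || (f == (m%:R + s : 'Z_3) :> nat).

Definition adm_next (s : 'Z_3) (f : nat) : 'Z_3 := s + f%:R.

Lemma enum_gf_adm (R : comNzRingType) (x : R) N L (s : 'Z_3) :
  x ^+ N = 0 -> enum_gf adm_mult adm_next N x L s = adm_gf x L s.
Proof.
move=> xN; elim: L s => [|L IH] s; first exact: enum_gf0.
have N0 := nilp_order_gt0 xN.
rewrite enum_gfS // (bigD1 (Ordinal N0)) // IH adm_gfS.
have : forall f, adm_mult L.+1 s f
    = (f == 0)%N || (f == (L.+1%:R + s : 'Z_3) :> nat) by [].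
move: (L.+1%:R + s : 'Z_3) => u msE.
rewrite mul0n mul1r [adm_next _ _]addr0; congr (_ + _).
have [u0|u0] := eqVneq u 0.
  rewrite !mul0r big1 // => f; rewrite msE u0 -val_eqE.
  by rewrite orbb => /andP[->].
have u0' : (u : nat) != 0%N by rewrite -val_eqE in u0.
rewrite mul1r; have [uN|Nu] := ltnP u N.
  rewrite (big_pred1 (Ordinal uN)); last first.
    move=> f; rewrite msE /= -[f == Ordinal uN]/(f == u :> nat).
    rewrite -[f == Ordinal N0]/(f == 0 :> nat)%N.
    by move: (u : nat) u0' {uN} => w; lia.
  by rewrite IH mulnC /adm_next natr_Zp.
rewrite big_pred0 => [|f].
  by rewrite (exp_nilp xN) ?mul0r //; nia.
rewrite msE -val_eqE /=; case: eqP => //= _.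
by rewrite andbT ltn_eqF // (leq_trans (ltn_ord f)).
Qed.

(** * Admissibility read from the largest part *)

Definition adm_link (m m' l l' : nat) : bool :=
  ((m%:Z + m'%:Z + l%:Z - l'%:Z)%R == 0%R %[mod 3])%Z.

Definition adm_from (s : nat) (p : seq nat) : bool :=
  let j := size (parts p) in
  [&& all (fun i => 0 < mult p i < 3)%N (iota 0 j),
      (0 < j)%N ==> (mult p 0 == part p 0 + s %[mod 3])%N
    & all (fun i => (i.+1 < j)%N ==>
        adm_link (mult p i) (mult p i.+1) (part p i) (part p i.+1)) (iota 0 j)].

(** Eliminating l gives m' = l' + s - 2m, and -2 = 1 modulo 3: the link depends on the past only
    through the number s + m of parts read. *)
Lemma adm_link_trans s m m' l l' :
  (m == l + s %[mod 3])%N ->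
  adm_link m m' l l' = (m' == l' + (s + m) %[mod 3])%N.
Proof. by rewrite /adm_link => e; lia. Qed.

Lemma forall_ord_all n (P : pred nat) :
  [forall i : 'I_n, P i] = all P (iota 0 n).
Proof.
apply/forallP/allP => [Pi i|Pi i]; last by apply: Pi; rewrite mem_iota /= add0n.
by rewrite mem_iota add0n => /= lt_in; exact: (Pi (Ordinal lt_in)).
Qed.

Lemma admissibleE p : admissible p = adm_from 0 p.
Proof. by rewrite /adm_from -!forall_ord_all addn0. Qed.

Lemma parts_nseq_cat f l p :
  l \notin p -> parts (nseq f.+1 l ++ p) = l :: parts p.
Proof.
move=> lp; rewrite /parts; elim: f => [|f IH] /=; first by rewrite (negPf lp).
by rewrite mem_head -IH.
Qed.

Lemma part_nseq_catS f l p i :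
  l \notin p -> part (nseq f.+1 l ++ p) i.+1 = part p i.
Proof. by move=> lp; rewrite /part parts_nseq_cat. Qed.

Lemma mult_nseq_cat0 f l p : l \notin p -> mult (nseq f.+1 l ++ p) 0 = f.+1.
Proof.
move=> lp; rewrite /mult /part parts_nseq_cat // count_cat count_nseq /= eqxx.
by rewrite mul1n (count_memPn lp) addn0.
Qed.

Lemma mult_nseq_catS f l p i :
  l \notin p -> (i < size (parts p))%N ->
  mult (nseq f.+1 l ++ p) i.+1 = mult p i.
Proof.
move=> lp ip; rewrite /mult part_nseq_catS // count_cat count_nseq /=.
have : part p i \in p by rewrite -mem_undup mem_nth.
by case: eqP => [<-|//]; rewrite (negPf lp).
Qed.

Lemma adm_from_nseq_cat s f l p :
  l \notin p ->
  adm_from s (nseq f.+1 l ++ p)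
    = [&& (f.+1 < 3)%N, (f.+1 == l + s %[mod 3])%N & adm_from (s + f.+1) p].
Proof.
move=> lp; rewrite /adm_from parts_nseq_cat //= -[X in iota X _]addn0 iotaDl
  !all_map.
set j := size (parts p).
have -> : mult (l :: nseq f l ++ p) 0 = f.+1 by exact: (mult_nseq_cat0 f lp).
have -> : part (l :: nseq f l ++ p) 0 = l.
  by rewrite /part (parts_nseq_cat f lp).
have -> : all (preim (addn 1)
      (fun i => 0 < mult (l :: nseq f l ++ p) i < 3)%N) (iota 0 j)
    = all (fun i => 0 < mult p i < 3)%N (iota 0 j).
  by apply: eq_in_all => i; rewrite mem_iota /= => ij;
    rewrite (mult_nseq_catS f lp).
have -> : all (preim (addn 1) (fun i => (i < j)%N ==>
      adm_link (mult (l :: nseq f l ++ p) i) (mult (l :: nseq f l ++ p) i.+1)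
        (part (l :: nseq f l ++ p) i) (part (l :: nseq f l ++ p) i.+1)))
          (iota 0 j)
    = all (fun i => (i.+1 < j)%N ==>
        adm_link (mult p i) (mult p i.+1) (part p i) (part p i.+1)) (iota 0 j).
  apply: eq_in_all => i; rewrite mem_iota /= => ij; case: ltnP => //= i1j.
  by rewrite !(mult_nseq_catS f lp) // !(part_nseq_catS f _ lp).
have [fl|_] := boolP (f.+1 == l + s %[mod 3])%N; last by rewrite !andbF.
have -> : (1 < j.+1)%N ==> adm_link f.+1 (mult (l :: nseq f l ++ p) 1) l
      (part (l :: nseq f l ++ p) 1)
    = (0 < j)%N ==> (mult p 0 == part p 0 + (s + f.+1) %[mod 3])%N.
  rewrite ltnS; have [//|j0] := posnP j.
  by rewrite /= (mult_nseq_catS f lp j0) (part_nseq_catS f 0 lp)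
    (adm_link_trans _ _ fl).
by rewrite -!andbA.
Qed.

Lemma eq_mod3_val (n : nat) (u : 'Z_3) :
  (n < 3)%N && (n == u %[mod 3])%N = (n == u :> nat).
Proof.
have u3 : (u < 3)%N by exact: ltn_ord u.
move: (u : nat) u3 => w w3; lia.
Qed.

Lemma val_Z3_addn (u : 'Z_3) (n : nat) :
  (n%:R + u : 'Z_3) = ((n + u) %% 3)%N :> nat.
Proof. by rewrite /= val_Zp_nat // modnDml. Qed.

Lemma adm_from_mod s s' p : (s = s' %[mod 3])%N -> adm_from s p = adm_from s' p.
Proof. by rewrite /adm_from => e; rewrite -modnDmr e modnDmr. Qed.

Lemma adm_mult_ok L (s : 'Z_3) p :
  parts_in L p -> adm_from s p = mult_ok adm_mult adm_next L s p.
Proof.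
elim: L s p => [|L IH] s p pL.
  by case: p pL => [|x p] //=; rewrite /parts_in /=; lia.
have [p' p'L ->] := parts_inS pL.
rewrite mult_ok_nseq_cat // /adm_mult /adm_next.
case: (count_mem L.+1 p) => [|f]; first by rewrite addr0 -IH.
rewrite adm_from_nseq_cat; last first.
  by apply/negP => /(allP (andP p'L).2); rewrite ltnn andbF.
rewrite andbA -IH // -eq_mod3_val val_Z3_addn modn_mod; congr (_ && _).
by apply: adm_from_mod; rewrite addrC val_Z3_addn modn_mod addnC.
Qed.

Lemma num_partitions_admissible (L n : nat) :
  (n <= L)%N ->
  num_partitions n%:Z admissible = size (enum_parts adm_mult adm_next L 0 n).
Proof.
move=> nL; apply: num_partitions_enum => // p pL.
by rewrite admissibleE -adm_mult_ok.
Qed.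

(** * Comparison of coefficients *)

Section NilpotentIdentity.

Variables (R : comNzRingType) (q : R) (N : nat).
Hypothesis qN : q ^+ N = 0.
Hypothesis R_eqN0 : forall y : R, y = - y -> y = 0.
Local Notation Q := (q ^+ 3).
Local Notation L := (15 * (2 * N))%N.

(** The bound on the parts consists of whole blocks of 15, and 2N blocks are enough for the limit of
    the triple product. *)
Definition avoid_series r : R := enum_gf (avoid_mult r) avoid_next N Q L tt.

Lemma avoid_series_theta r :
  r \in [:: 1; 2; 4; 7]%N -> qpoch Q N * avoid_series r = theta_sum q r (2 * N).
Proof.
move=> r_in; have QN := Q_nilp qN.
have Q15 : (Q ^+ 15) ^+ N = 0 by rewrite -exprM mulnC exprM QN expr0n.
rewrite -(qpoch_stable QN (_ : (N <= L)%N)); last lia.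
rewrite (qpoch_avoid_prod Q (2 * N) r_in) -mulrA [avoid_prod _ _ _ * _]mulrC.
rewrite avoid_gf // mulr1 (qpoch_stable Q15) ?theta_sum_prod //; last lia.
by move: r_in; rewrite !inE => /or4P[] /eqP ->.
Qed.

Lemma adm_avoid_series :
  enum_gf adm_mult adm_next N q L 0
    = avoid_series 7 - Q * avoid_series 2
      + q * (avoid_series 4 + Q * avoid_series 1).
Proof.
(* By stability any large index may replace N + 1; this one has the form required by the limits of
   the alternating sums. *)
have QN := Q_nilp qN; pose M := (3 * (2 * N)).+1.
rewrite enum_gf_adm // (adm_gf_lim qN); last lia.
have [vE _] := poly_bosE q R_eqN0 M; have [_ eE] := poly_bosE q R_eqN0 M.
have -> : vac_poly q N.+1 = vac_bos q M.
  by rewrite -vE /vac_poly !(word_sum_stable qN) // /M; lia.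
have -> : eps_poly q N.+1 = eps_bos q M.
  by rewrite -eE /eps_poly !(word_sum_stable qN) // /M; lia.
apply: (qpoch_cancel QN (n := N)); rewrite mulrDr.
rewrite vac_bos_lim ?eps_bos_lim //; try lia.
rewrite -!avoid_series_theta //; ring.
Qed.

End NilpotentIdentity.

(** * Transfer from the truncated ring to integer coefficients *)

Lemma in_qpoly_Xn_coef (A : comNzRingType) N (p p' : {poly A}) i :
  (i < N)%N -> in_qpoly 'X^N p = in_qpoly 'X^N p' -> p`_i = p'`_i.
Proof.
case: N => // N iN /(congr1 val) /=; rewrite mk_monic_Xn /= => e.
have XN : ('X^(N.+1) : {poly A}) \is monic by exact: monicXn.
have E (r : {poly A}) : r`_i = (Pdiv.CommonRing.rmodp r 'X^(N.+1))`_i.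
  rewrite {1}(@Pdiv.RingMonic.rdivp_eq _ _ XN r).
  by rewrite coefD coefMXn iN add0r.
by rewrite E e -E.
Qed.

Lemma qpoly_eqN0 N (y : {poly %/ ('X^N : {poly int})}) : y = - y -> y = 0.
Proof.
move=> /(congr1 val) /= e; apply: val_inj => /=; apply/polyP => i.
have int_eqN0 (z : int) : z = - z -> z = 0 by lia.
by rewrite coef0; apply: int_eqN0; rewrite {1}e coefN.
Qed.

Definition step_poly (c : nat -> nat) (w N : nat) : {poly int} :=
  \sum_(n < N) (c n)%:R * 'X^w ^+ n.

Lemma coef_step_poly c w N i :
  (i < N)%N -> (0 < w)%N ->
  (step_poly c w N)`_i = if (w %| i)%N then (c (i %/ w)%N)%:Z else 0.
Proof.
move=> iN w0; rewrite /step_poly coef_sum.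
have E n : ((c n)%:R * 'X^w ^+ n : {poly int})`_i
  = if i == (w * n)%N then (c n)%:Z else 0.
  by rewrite -exprM -polyC_natr coefCM coefXn; case: eqP;
    rewrite ?mulr1 ?mulr0 // natz.
under eq_bigr => n _ do rewrite E.
rewrite -big_mkcond /=; case: ifP => [/dvdnP[k ik]|wi].
  have kN : (k < N)%N by nia.
  rewrite (big_pred1 (Ordinal kN)) ?ik ?mulnK //= => n.
  by rewrite /= -[RHS]/(n == k :> nat) mulnC eqn_pmul2l // eq_sym.
by rewrite big_pred0 // => n; apply: contraFF wi => /eqP ->; rewrite dvdn_mulr.
Qed.

Section Truncation.

Variable N : nat.
Local Notation L := (15 * (2 * N))%N.
Local Notation count_avoid r :=
  (fun n => size (enum_parts (avoid_mult r) avoid_next L tt n)).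
Local Notation count_adm :=
  (fun n => size (enum_parts adm_mult adm_next L 0 n)).

Lemma step_poly_identity i :
  (i < N)%N ->
  (step_poly count_adm 1 N)`_i
    = (step_poly (count_avoid 7) 3 N - 'X^3 * step_poly (count_avoid 2) 3 N
       + 'X * (step_poly (count_avoid 4) 3 N
         + 'X^3 * step_poly (count_avoid 1) 3 N))`_i.
Proof.
move=> iN; apply: (in_qpoly_Xn_coef iN).
pose phi : {rmorphism {poly int} -> {poly %/ ('X^N : {poly int})}} :=
  in_qpoly 'X^N.
rewrite -![in_qpoly _ _]/(phi _); pose q := phi 'X.
have qN : q ^+ N = 0.
  rewrite -rmorphXn; apply/val_inj => /=.
  case: N iN => // N' _; rewrite mk_monic_Xn /=.
  exact/Pdiv.RingMonic.rmodpp/monicXn.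
have E c w : phi (step_poly c w N) = \sum_(n < N) (c n)%:R * (q ^+ w) ^+ n.
  rewrite /step_poly rmorph_sum; apply: eq_bigr => n _.
  by rewrite rmorphM rmorph_nat !rmorphXn.
rewrite !(rmorphD, rmorphN, rmorphM, rmorphXn) !E -/q.
exact: (adm_avoid_series qN (@qpoly_eqN0 N)).
Qed.

End Truncation.

Lemma step_poly_coef3 c N i :
  (i < N)%N ->
  (step_poly c 3 N)`_i = if (3 %| i)%N then (c (i %/ 3)%N)%:Z else 0.
Proof. by move=> iN; apply: coef_step_poly. Qed.

Lemma admissible_mod0_count (k : nat) :
  (num_partitions (3 * k)%N%:Z admissible)%:Z
    = (num_partitions k%:Z (parts_avoid 7))%:Z
      - (num_partitions (k%:Z - 1) (parts_avoid 2))%:Z.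
Proof.
pose N := (3 * k).+1; have iN : (3 * k < N)%N by [].
have := step_poly_identity iN; rewrite coef_step_poly // dvd1n divn1.
rewrite -num_partitions_admissible; last by rewrite /N; lia.
rewrite coefD coefB coefXM coefXnM step_poly_coef3 // dvdn_mulr // mulKn //
  => ->.
rewrite -num_partitions_avoid //; last by rewrite /N; lia.
case: k N iN => [|k] N iN.
  by rewrite subr0 addr0 (@num_partitions_neg _ (parts_avoid 2)) // subr0.
have -> : k.+1%:Z - 1 = k%:Z by lia.
have -> : (3 * k.+1 - 3 = 3 * k)%N by lia.
(* The factor 'X lowers the index to 3k + 2, not a multiple of 3, so the series in 'X^3 behind it
   contribute nothing. *)
have -> : ((3 * k.+1).-1 = 3 * k + 2)%N by lia.
rewrite !ifF; try lia.
rewrite coefD coefXnM !step_poly_coef3; try lia.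
rewrite dvdn_mulr // mulKn // -num_partitions_avoid //; last lia.
have -> : (3 %| 3 * k + 2)%N = false by lia.
rewrite add0r; case: ltnP => k0; first by rewrite addr0.
by rewrite (_ : (3 %| 3 * k + 2 - 3)%N = false) ?addr0 //; lia.
Qed.

Lemma admissible_mod1_count (k : nat) :
  (num_partitions (3 * k).+1%:Z admissible)%:Z
    = (num_partitions k%:Z (parts_avoid 4))%:Z
      + (num_partitions (k%:Z - 1) (parts_avoid 1))%:Z.
Proof.
pose N := (3 * k).+2; have iN : ((3 * k).+1 < N)%N by [].
have := step_poly_identity iN; rewrite coef_step_poly // dvd1n divn1.
rewrite -num_partitions_admissible; last by rewrite /N; lia.
rewrite coefD coefB coefXM coefXnM step_poly_coef3 //= => ->.
rewrite coefD coefXnM !step_poly_coef3; try by rewrite /N; lia.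
rewrite dvdn_mulr // mulKn //.
have -> : (3 %| (3 * k).+1)%N = false by lia.
rewrite (_ : (if ((3 * k).+1 < 3)%N then 0 else _) = 0 :> int); last first.
  case: ltnP => // k0.
  by rewrite (_ : (3 %| (3 * k).+1 - 3)%N = false) //; lia.
rewrite subr0 add0r -num_partitions_avoid //; last by rewrite /N; lia.
case: k N iN => [|k] N iN.
  by rewrite (@num_partitions_neg _ (parts_avoid 1)).
have -> : k.+1%:Z - 1 = k%:Z by lia.
have -> : (3 * k.+1 - 3 = 3 * k)%N by lia.
rewrite ifF ?dvdn_mulr ?mulKn -?num_partitions_avoid //; lia.
Qed.

Theorem theorem5p1 :
  (forall k : int, 0 <= k -> a k = c k) /\
  (forall k : int, 1 <= k -> b k = d k).
Proof.
split=> [[k|//] _|[[//|k]|//] _].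
  exact: admissible_mod0_count.
rewrite /b /d (_ : 3 * k.+1%:Z - 2 = (3 * k).+1%:Z); last lia.
have -> : k.+1%:Z - 1 = k%:Z by lia.
have -> : k.+1%:Z - 2 = k%:Z - 1 by lia.
exact: admissible_mod1_count.
Qed.
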